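(* $\mathcal{L}_{\text{comp}}$ is not finitely axiomatizable over $\mathsf{AX}_{\text{base}}$: there is no finite set of axiom schemes such that the set of $\mathcal{L}_{\text{comp}}$-formulas derivable from $\mathsf{AX}_{\text{base}}$ together with all instances of these schemes is exactly the set of $\mathcal{L}_{\text{comp}}$-formulas true in every probability model.
   Context: Let $\mathsf{Prop}$ be a countably infinite set of proposition letters; $\sigma(\mathsf{Prop})$ is the set of Boolean combinations over $\mathsf{Prop}$. $\mathcal{L}_{\text{comp}}$ is the set of Boolean combinations (via $\neg,\wedge$) of atoms $\mathbf{P}(\alpha)\succsim\mathbf{P}(\beta)$ with $\alpha,\beta\in\sigma(\mathsf{Prop})$. A model is $\mathfrak{M}=(\Omega,\mathcal{F},\mathbb{P},[\![\cdot]\!])$ with $(\Omega,\mathcal{F},\mathbb{P})$ a probability space and $[\![\cdot]\!]:\sigma(\mathsf{Prop})\to\wp(\Omega)$ a Boolean valuation with $[\![A]\!]\in\mathcal{F}$ for $A\in\mathsf{Prop}$; $\mathfrak{M}\models\mathbf{P}(\alpha)\succsim\mathbf{P}(\beta)$ iff $\mathbb{P}([\![\alpha]\!])\geq\mathbb{P}([\![\beta]\!])$, and Boolean connectives are evaluated as usual. $\mathsf{AX}_{\text{base}}$ consists of: $\mathsf{Lin}$ (transitivity and comparability of $\succsim$); $\mathsf{Bool}$ (Boolean reasoning: all instances of propositional tautologies and modus ponens); $\mathsf{Dist}$ ($\mathbf{P}(\alpha)\succsim\mathbf{P}(\beta)$ whenever $\beta\to\alpha$ is a propositional tautology); $\mathsf{NonDeg}$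 ($\neg\,\mathbf{P}(\bot)\succsim\mathbf{P}(\top)$). An axiom scheme is an expression $\varphi(\alpha_1,\dots,\alpha_k)$ obtained from an $\mathcal{L}_{\text{comp}}$-formula by regarding its proposition letters as metavariables $\alpha_1,\dots,\alpha_k$ ranging over Boolean formulas; its instances are the $\mathcal{L}_{\text{comp}}$-formulas obtained by uniformly substituting formulas of $\sigma(\mathsf{Prop})$ for $\alpha_1,\dots,\alpha_k$. No inference rules other than those of $\mathsf{AX}_{\text{base}}$ are allowed. *)

(* Defs.v *)
From HB Require Import structures.
From mathcomp Require Import all_boot all_order all_algebra.
From mathcomp Require Import boolp classical_sets functions cardinality.
From mathcomp Require Import reals ereal measure.

Set Implicit Arguments.
Unset Strict Implicit.
Unset Printing Implicit Defensive.

Local Open Scope classical_set_scope.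

(* sigma(Prop): the countably many proposition letters are indexed by nat.
   The constant bot is primitive, so that it contains no letter and is fixed by
   substitution. *)
Inductive bform : Type :=
| BLetter of nat
| BBot
| BNeg of bform
| BAnd of bform & bform.

Definition BTop : bform := BNeg BBot.
Definition BImp (a b : bform) : bform := BNeg (BAnd a (BNeg b)).

Fixpoint beval (v : nat -> bool) (a : bform) : bool :=
  match a with
  | BLetter n => v n
  | BBot => false
  | BNeg b => ~~ beval v b
  | BAnd b c => beval v b && beval v c
  end.

Definition btautology (a : bform) : Prop := forall v, beval v a.

Fixpoint bsubst (s : nat -> bform) (a : bform) : bform :=
  match a with
  | BLetter n => s n
  | BBot => BBot
  | BNeg b => BNeg (bsubst s b)
  | BAnd b c => BAnd (bsubst s b) (bsubst s c)
  end.

(* CGeq a b stands for P(a) >= P(b). *)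
Inductive cform : Type :=
| CGeq of bform & bform
| CNeg of cform
| CAnd of cform & cform.

Definition COr (f g : cform) : cform := CNeg (CAnd (CNeg f) (CNeg g)).
Definition CImp (f g : cform) : cform := CNeg (CAnd f (CNeg g)).

(* Propositional evaluation: the comparisons are treated as opaque atoms. *)
Fixpoint ceval (v : bform -> bform -> bool) (f : cform) : bool :=
  match f with
  | CGeq a b => v a b
  | CNeg g => ~~ ceval v g
  | CAnd g h => ceval v g && ceval v h
  end.

Definition ctautology (f : cform) : Prop := forall v, ceval v f.

Fixpoint csubst (s : nat -> bform) (f : cform) : cform :=
  match f with
  | CGeq a b => CGeq (bsubst s a) (bsubst s b)
  | CNeg g => CNeg (csubst s g)
  | CAnd g h => CAnd (csubst s g) (csubst s h)
  end.

(* Derivability from AX_base plus all instances of the schemes in S; a scheme is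
   a formula whose letters are read as metavariables. *)
Inductive derivable (S : set cform) : cform -> Prop :=
| der_scheme f s : S f -> derivable S (csubst s f)
| der_trans a b c :
    derivable S (CImp (CAnd (CGeq a b) (CGeq b c)) (CGeq a c))
| der_compar a b : derivable S (COr (CGeq a b) (CGeq b a))
| der_taut f : ctautology f -> derivable S f
| der_mp f g : derivable S (CImp f g) -> derivable S f -> derivable S g
| der_dist a b : btautology (BImp b a) -> derivable S (CGeq a b)
| der_nondeg : derivable S (CNeg (CGeq BBot BTop)).

Record model (R : realType) := Model {
  model_display : measure_display;
  model_space : measurableType model_display;
  model_prob : probability model_space R;
  model_val : bform -> set model_space;
  model_val_bot : model_val BBot = set0;
  model_val_neg : forall a, model_val (BNeg a) = ~` model_val a;
  model_val_and : forall a b,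
    model_val (BAnd a b) = model_val a `&` model_val b;
  model_val_letter : forall n, measurable (model_val (BLetter n))
}.

Arguments model_prob {R} m.
Arguments model_val {R} m _.

Fixpoint sat (R : realType) (M : model R) (f : cform) : Prop :=
  match f with
  | CGeq a b =>
      (model_prob M (model_val M b) <= model_prob M (model_val M a))%E
  | CNeg g => ~ sat M g
  | CAnd g h => sat M g /\ sat M h
  end.

Definition valid (R : realType) (f : cform) : Prop :=
  forall M : model R, sat M f.

(* Main.v *)
Require Import Defs.
From mathcomp Require Import all_boot all_order all_algebra.
From mathcomp Require Import boolp classical_sets functions cardinality.
From mathcomp Require Import reals ereal measure.
From HB Require Import structures.
From mathcomp Require Import lra.

(** Why the theorem holds. A finite set of schemes mentions at most K letters,
    so in a fixed structure each instance of such a scheme only sees the Boolean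
    subalgebra generated by K sets. Hence it suffices to build, for every K, a
    comparison of the subsets of a finite set which is a total, transitive,
    monotone and nondegenerate relation, which agrees with some probability on
    every subalgebra generated by K sets, and which violates some valid formula.
    The first properties make every derivable formula true in this structure
    ([derivable_sound]): an instance of a scheme is true because the scheme
    itself is valid and the relevant subalgebra carries a genuine model. The
    last one shows that some valid formula is not derivable.

    The points of the structure are the pairs [q = (P, N)] of subsets of
    [{0, ..., m-1}], and the i-th vector [tilt i], with entries in {-1, 0, 1},
    has at [q] the entry [i in P] - [i in N] if P and N are equinumerous, and 0
    otherwise. Each [tilt i] is the difference of the indicators of two sets,
    [gain i] and [loss i]. The tilts sum to zero, so no probability can make
    every [gain i] at least as likely as [loss i] and [gain 0] strictly more
    likely than [loss 0]; this is a valid formula, [cancellation]. On the other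
    hand there are so many points that the span of the tilts contains no other
    difference of indicators than 0 and the tilts and their opposites
    ([span_tilt]). A generic positive weight orthogonal to the tilts
    ([generic_weight]) therefore has no ties besides those between A and B with
    A - B a tilt up to sign ([balance_weight]). The comparison [pref] follows
    this weight, and resolves the ties along [tilt 0], in favour of the [gain 0]
    side, and no other.

    A subalgebra generated by K sets has at most [2 ^ K] atoms, and if m is
    large, it fails to contain both [gain j] and [loss j] for some [j != 0]
    ([unresolved_tilt]). A small extra weight on the point [({0}, {j})], where
    [tilt 0] is 1, [tilt j] is -1 and all other tilts vanish, then breaks the
    ties along [tilt 0] as desired, and along [tilt j], which the subalgebra
    does not see ([pref_representable]). *)

Set Implicit Arguments.
Unset Strict Implicit.
Unset Printing Implicit Defensive.

Import Order.TTheory GRing.Theory Num.Theory.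
Local Open Scope ring_scope.

(** * Weights with prescribed ties *)

(** Perturbations by a small enough multiple of a vector preserve finitely many
    strict inequalities. *)
Lemma small_step (R : realFieldType) (s : seq (R * R)) :
  exists2 e : R, 0 < e & {in s, forall p, 0 < p.1 -> e * `|p.2| < p.1}.
Proof.
elim: s => [|[x y] s [e e0 IH]]; first by exists 1.
have [x0|x0] := ltP 0 x; last first.
  exists e => // p; rewrite inE => /predU1P[->/=|/IH//].
  by rewrite ltNge x0.
have y1 : 0 < `|y| + 1 by rewrite ltr_wpDl.
exists (Num.min e (x / (`|y| + 1))) => [|p].
  by rewrite lt_min e0 divr_gt0.
rewrite inE => /predU1P[->/= _|ps p0].
  apply: (@le_lt_trans _ _ (x / (`|y| + 1) * `|y|)).
    by rewrite ler_wpM2r // ge_min lexx orbT.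
  by rewrite mulrAC ltr_pdivrMr // ltr_pM2l // ltrDl.
apply: le_lt_trans (IH _ ps p0).
by rewrite ler_wpM2r // ge_min lexx.
Qed.

(** The columns of the cokernel of the matrix with rows [z i] are linear forms
    that vanish on its row space, and they detect the vectors outside it. *)
Lemma span_or_separated (R : fieldType) (T : finType) m
    (z : 'I_m -> T -> R) (d : T -> R) :
  (exists c : 'I_m -> R, forall q, d q = \sum_i c i * z i q) \/
  (exists2 v : T -> R, forall i, \sum_q v q * z i q = 0 &
     \sum_q v q * d q != 0).
Proof.
pose Z := \matrix_(i < m, k < #|T|) z i (enum_val k).
pose D := \row_(k < #|T|) d (enum_val k).
have [/submxP[E DE]|] := boolP (D <= Z)%MS; [left|move=> DZ; right].
  exists (E ord0) => q.
  have := congr1 (fun M : 'rV_ _ => M ord0 (enum_rank q)) DE.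
  rewrite !mxE enum_rankK => ->.
  by apply: eq_bigr => i _; rewrite !mxE enum_rankK.
move: DZ; rewrite submxE => /rV0Pn[j Dj].
exists (fun q => cokermx Z (enum_rank q) j) => [i|].
  have := congr1 (fun M : 'M_(_, _) => M i j) (mulmx_coker Z).
  rewrite !mxE => E; rewrite -[RHS]E (reindex (@enum_val T predT)) /=.
    by apply: eq_bigr => k _; rewrite [Z _ _]mxE enum_valK mulrC.
  by exists enum_rank => k _; rewrite ?enum_valK ?enum_rankK.
move: Dj; rewrite !mxE; congr (_ != _).
rewrite [RHS](reindex (@enum_val T predT)) /=.
  by apply: eq_bigr => k _; rewrite [D _ _]mxE enum_valK mulrC.
by exists enum_rank => k _; rewrite ?enum_valK ?enum_rankK.
Qed.

(** The weights orthogonal to every [z i] form a linear space, in which those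
    orthogonal to a given vector outside the span of the [z i] form a proper
    subspace. Finitely many proper subspaces are avoided one after the other, by
    small perturbations of the constant weight 1. *)
Lemma generic_weight (R : realFieldType) (T : finType) m
    (z : 'I_m -> T -> R) (D : eqType) (d : D -> T -> R) (s : seq D) :
  (forall i, \sum_q z i q = 0) ->
  exists mu : T -> R,
    [/\ forall q, 0 < mu q, forall i, \sum_q mu q * z i q = 0 &
        {in s, forall x, \sum_q mu q * d x q = 0 ->
           exists c : 'I_m -> R, forall q, d x q = \sum_i c i * z i q}].
Proof.
move=> z0; elim: s => [|x s [mu [mu0 muz mus]]].
  exists (fun=> 1); split => // i.
  by rewrite -[RHS](z0 i); apply: eq_bigr => q _; rewrite mul1r.
have [xspan|[v vz vx]] := span_or_separated z (d x).
  by exists mu; split => // y; rewrite inE => /predU1P[->|/mus].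
have [mux|mux] := eqVneq (\sum_q mu q * d x q) 0; last first.
  exists mu; split => // y; rewrite inE => /predU1P[-> /eqP|/mus//].
  by rewrite (negPf mux).
pose bounds := [seq (mu q, v q) | q <- enum T] ++
  [seq (`|\sum_q mu q * d y q|, \sum_q v q * d y q) | y <- s].
have [e e0 eP] := small_step bounds.
have sumE (w : T -> R) : \sum_q (mu q + e * v q) * w q =
    \sum_q mu q * w q + e * \sum_q v q * w q.
  rewrite mulr_sumr -big_split; apply: eq_bigr => q _.
  by rewrite mulrDl mulrA.
exists (fun q => mu q + e * v q); split=> [q|i|y].
- have /eP/(_ (mu0 q))/= : (mu q, v q) \in bounds.
    by rewrite mem_cat map_f ?mem_enum.
  rewrite -{1}(gtr0_norm e0) -normrM ltr_norml => /andP[+ _].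
  by rewrite -subr_gt0 opprK addrC.
- by rewrite sumE muz vz mulr0 addr0.
rewrite inE sumE => /predU1P[->|ys].
  by rewrite mux add0r => /eqP; rewrite mulf_eq0 (negPf vx) gt_eqF.
have [muy _|muy] := eqVneq (\sum_q mu q * d y q) 0; first exact: mus.
have /eP/= : (`|\sum_q mu q * d y q|, \sum_q v q * d y q) \in bounds.
  rewrite mem_cat; apply/orP; right.
  exact: (map_f (fun y => (`|\sum_q mu q * d y q|, \sum_q v q * d y q))).
rewrite normr_gt0 => /(_ muy) + /eqP.
rewrite addr_eq0 => + /eqP E.
by rewrite E normrN normrM (gtr0_norm e0) ltxx.
Qed.

(** * Balances *)

(** The index [i] is an object and [(P, N)] a way to load the two pans of a pair
    of scales. Only loads with equally many objects in both pans count: this is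
    what makes the tilts of all objects cancel out. An object in both pans has
    no effect. *)
Definition balance (m : nat) := ({set 'I_m} * {set 'I_m})%type.

Definition gain m (i : 'I_m) : {set balance m} :=
  [set q : balance m | [&& #|q.1| == #|q.2|, i \in q.1 & i \notin q.2]]%SET.

Definition loss m (i : 'I_m) : {set balance m} :=
  [set q : balance m | [&& #|q.1| == #|q.2|, i \in q.2 & i \notin q.1]]%SET.

Definition diff (R : pzRingType) (T : finType) (A B : {set T}) (q : T) : R :=
  (q \in A)%:R - (q \in B)%:R.

Definition tilt (R : pzRingType) m (i : 'I_m) : balance m -> R :=
  diff R (gain i) (loss i).

Lemma tiltE (R : pzRingType) m (i : 'I_m) (q : balance m) : tilt R i q =
  if #|q.1| == #|q.2| then (i \in q.1)%:R - (i \in q.2)%:R else 0.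
Proof.
rewrite /tilt /diff !inE; case: eqP => _ /=; last by rewrite subrr.
by do 2!case: (_ \in _); rewrite /= ?subrr.
Qed.

Lemma sum_tilt (R : pzRingType) m (q : balance m) : \sum_i tilt R i q = 0.
Proof.
under eq_bigr do rewrite tiltE.
case: eqP => [E|_]; last by rewrite big1.
rewrite sumrB -!natr_sum -!big_mkcond /= !sum1_card E subrr //.
Qed.

(** Swapping the pans reverses the tilt. *)
Lemma total_tilt (R : numDomainType) m (i : 'I_m) : \sum_q tilt R i q = 0.
Proof.
have swapE : \sum_q tilt R i q = - \sum_q tilt R i q.
  rewrite -sumrN (reindex (fun q : balance m => (q.2, q.1))) /=.
    apply: eq_bigr => q _; rewrite !tiltE /= eq_sym.
    by case: ifP => _; rewrite ?oppr0 ?opprB.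
  by exists (fun q : balance m => (q.2, q.1)) => -[].
by apply/eqP; move/eqP: swapE; rewrite -addr_eq0 -mulr2n mulrn_eq0.
Qed.

Lemma diff_cases (R : numDomainType) (T : finType) (A B : {set T}) q :
  [|| diff R A B q == -1, diff R A B q == 0 | diff R A B q == 1].
Proof.
by rewrite /diff; do 2!case: (_ \in _);
  rewrite ?subrr ?subr0 ?sub0r ?eqxx ?orbT.
Qed.

Lemma diff_eq0 (R : numDomainType) (T : finType) (A B : {set T}) :
  diff R A B =1 (fun=> 0) -> A = B.
Proof.
move=> d0; apply/setP => q; have /eqP := d0 q.
by rewrite /diff subr_eq0 eqr_nat; do 2!case: (_ \in _).
Qed.

Lemma tilt_pair (R : pzRingType) m (i j k : 'I_m) :
  tilt R i ([set j], [set k])%SET = (i == j)%:R - (i == k)%:R.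
Proof. by rewrite tiltE /= !cards1 !inE. Qed.

Lemma tilt_quad (R : pzRingType) m (i j j' k k' : 'I_m) :
  j != j' -> k != k' ->
  tilt R i ([set j; j'], [set k; k'])%SET =
    (i == j)%:R + (i == j')%:R - ((i == k)%:R + (i == k')%:R).
Proof.
move=> jj kk; rewrite tiltE /= !cards2 jj kk eqxx !inE.
have UE (x y : 'I_m) : x != y ->
    ((i == x) || (i == y))%:R = (i == x)%:R + (i == y)%:R :> R.
  by case: (eqVneq i x) => [->|_] => [/negPf->|]; rewrite ?addr0 ?add0r.
by rewrite !UE.
Qed.

Lemma sum_delta (R : pzRingType) m (b : 'I_m -> R) j :
  \sum_i b i * (i == j)%:R = b j.
Proof.
rewrite (bigD1 j) //= eqxx mulr1 big1 ?addr0 // => i /negPf->.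
by rewrite mulr0.
Qed.

(** The loads with one object in each pan force the coefficients to differ
    pairwise by at most 1, so that up to a common shift, which changes nothing
    because the tilts sum to zero, they are the indicator of a set U. A load
    with two objects of U against two objects outside U would have the value 2,
    so U or its complement has at most one element. *)
Lemma span_tilt (R : realFieldType) m (A B : {set balance m}) (c : 'I_m -> R) :
  (forall q, diff R A B q = \sum_i c i * tilt R i q) ->
  A = B \/ exists i, diff R A B =1 tilt R i \/ diff R B A =1 tilt R i.
Proof.
case: m A B c => [|m] A B c dc.
  by left; apply: (@diff_eq0 R) => q; rewrite dc big_ord0.
(* Shifting by the least coefficient normalizes the coefficients to 0 and 1. *)
pose k := [arg min_(i < ord0) c i]%O.
have kP i : c k <= c i by rewrite /k; case: arg_minP => // j _; apply.
pose b i := c i - c k.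
have db q : diff R A B q = \sum_i b i * tilt R i q.
  under [RHS]eq_bigr do rewrite mulrBl.
  by rewrite sumrB -mulr_sumr sum_tilt mulr0 subr0.
have b01 i : b i = 0 \/ b i = 1.
  have := diff_cases R A B ([set i], [set k])%SET; rewrite db.
  under eq_bigr do rewrite tilt_pair mulrBr.
  have bi0 : 0 <= b i by rewrite subr_ge0.
  have bk : b k = 0 by rewrite /b subrr.
  rewrite sumrB !sum_delta bk subr0.
  by case/or3P => /eqP bi; [move: bi0; rewrite bi; lra|left|right].
pose U := [set i | b i == 1]%SET.
have bE i : b i = (i \in U)%:R.
  by rewrite inE; case: (b01 i) => ->; rewrite ?eqxx // eq_sym oner_eq0.
have [U1|U1] := leqP #|U| 1.
  move: U1; rewrite leq_eqVlt ltnS leqn0 cards_eq0.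
  case/orP => [/cards1P[i Ui]|/eqP U0].
    right; exists i; left => q; rewrite db -(sum_delta (fun j => tilt R j q) i).
    by apply: eq_bigr => j _; rewrite bE Ui inE mulrC.
  left; apply: (@diff_eq0 R) => q.
  by rewrite db big1 // => i _; rewrite bE U0 inE mul0r.
(* If only [k] is outside U, the sum is minus the tilt of [k]. *)
have [V1|V1] := leqP #|~: U|%SET 1.
  right; exists k; right => q.
  have {V1} Uk : (~: U = [set k])%SET.
    apply/esym/eqP; rewrite eqEcard cards1 V1 andbT finset.sub1set !inE.
    by rewrite /b subrr eq_sym oner_eq0.
  have -> : diff R B A q = - diff R A B q by rewrite /diff opprB.
  rewrite db -(sum_delta (fun j => tilt R j q) k).
  apply/eqP; rewrite eq_sym -addr_eq0 -big_split /=.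
  rewrite -[X in _ == X](sum_tilt R q); apply/eqP/eq_bigr => j _; rewrite bE.
  have := finset.in_setC j U; rewrite Uk inE => ->.
  by case: (j \in U); rewrite /= ?mul1r ?mulr0 ?mulr1 ?mul0r ?add0r ?addr0.
have /card_gt1P[i [j [iU jU ij]]] := U1.
have /card_gt1P[h [l []]] := V1; rewrite !finset.in_setC => hU lU hl.
have := diff_cases R A B ([set i; j], [set h; l])%SET; rewrite db.
under eq_bigr do rewrite tilt_quad // mulrBr !mulrDr.
rewrite sumrB !big_split /= !sum_delta !bE iU jU.
rewrite (negPf hU) (negPf lU).
by case/or3P => /eqP /= E; exfalso; move: E; clear; lra.
Qed.

(** * An almost representable comparison *)

Definition weight (R : pzRingType) (T : finType) (mu : T -> R)
    (A : {set T}) : R :=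
  \sum_(q in A) mu q.

(** Among sets of equal weight, those for which [gain ord0] can be exchanged for
    [loss ord0] are preferred. *)
Definition tiebreak n (A : {set balance n.+4}) : bool :=
  (gain ord0 \subset A) && [disjoint A & loss ord0].

Definition pref (R : realFieldType) n (mu : balance n.+4 -> R)
    (A B : {set balance n.+4}) : bool :=
  (weight mu B < weight mu A) ||
  ((weight mu A == weight mu B) && (tiebreak B ==> tiebreak A)).

Lemma sum_diff (R : pzRingType) (T : finType) (mu : T -> R) (A B : {set T}) :
  \sum_q mu q * diff R A B q = weight mu A - weight mu B.
Proof.
rewrite /weight [in X in X - _]big_mkcond [in X in _ - X]big_mkcond -sumrB.
apply: eq_bigr => q _; rewrite /diff mulrBr.
by do 2!case: (_ \in _); rewrite /= ?mulr1 ?mulr0.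
Qed.

Lemma balance_weight (R : realFieldType) m : exists mu : balance m -> R,
  [/\ forall q, 0 < mu q, forall i, weight mu (gain i) = weight mu (loss i) &
   forall A B, weight mu A = weight mu B ->
     A = B \/ exists i, diff R A B =1 tilt R i \/ diff R B A =1 tilt R i].
Proof.
have [mu [mu0 mut muD]] := generic_weight
  (fun X : {set balance m} * {set balance m} => diff R X.1 X.2)
  (enum [set: {set balance m} * {set balance m}]%SET) (@total_tilt R m).
exists mu; split=> // [i|A B AB].
  by apply/eqP; rewrite -subr_eq0 -sum_diff; apply/eqP/mut.
have [||c] := muD (A, B); first by rewrite mem_enum finset.in_setT.
  by rewrite sum_diff AB subrr.
exact: span_tilt.
Qed.

Lemma diff_eq1 (R : numDomainType) (T : finType) (A B : {set T}) q :
  diff R A B q = 1 -> q \in A /\ q \notin B.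
Proof.
move=> /eqP; rewrite /diff; do 2!case: (_ \in _) => //=.
- by rewrite subrr eq_sym oner_eq0.
- by rewrite sub0r eq_sym -subr_eq0 opprK -mulr2n pnatr_eq0.
- by rewrite subrr eq_sym oner_eq0.
Qed.

Lemma gainP (R : numDomainType) m (i : 'I_m) q :
  reflect (tilt R i q = 1) (q \in gain i).
Proof.
apply: (iffP idP) => [|/diff_eq1[]//].
rewrite tiltE inE => /and3P[/eqP-> -> /negPf->].
by rewrite eqxx subr0.
Qed.

Lemma lossP (R : numDomainType) m (i : 'I_m) q :
  reflect (tilt R i q = -1) (q \in loss i).
Proof.
apply: (iffP idP) => [|E].
  rewrite tiltE inE => /and3P[/eqP-> -> /negPf->].
  by rewrite eqxx sub0r.
have /diff_eq1[] // : diff R (loss i) (gain i) q = 1.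
by rewrite -[RHS]opprK -E /tilt /diff opprB.
Qed.

(** A preferred set contains all of [gain ord0] and avoids [loss ord0]. A move
    along another tilt [i] is incompatible with this at the load of [i]
    against 0, and at a load of 0 and [i] against two other objects; the latter
    is where four objects are needed. *)
Lemma tilt_no_tiebreak (R : numDomainType) n (i : 'I_n.+4)
    (A B : {set balance n.+4}) :
  i != ord0 -> diff R A B =1 tilt R i ->
  tiebreak A = false /\ tiebreak B = false.
Proof.
move=> i0 AB; split; apply/negP => /andP[/fintype.subsetP gA dA].
  pose q : balance n.+4 := ([set i], [set ord0])%SET.
  have /diff_eq1[qA _] : diff R A B q = 1.
    by rewrite AB tilt_pair eqxx (negPf i0) subr0.
  have ql : q \in loss ord0.
    by apply/(lossP R); rewrite tilt_pair eqxx eq_sym (negPf i0) sub0r.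
  by have := disjointFr dA qA; rewrite ql.
have [k [k' [ki ki' k0 k0' kk]]] : exists k k' : 'I_n.+4,
    [/\ k != i, k' != i, k != ord0, k' != ord0 & k != k'].
  have : (1 < #|~: [set i; ord0]|%SET)%N.
    by rewrite cardsCs finset.setCK card_ord cards2 i0.
  case/card_gt1P => k [k' []]; rewrite !inE !negb_or.
  by move=> /andP[? ?] /andP[? ?] ?; exists k, k'.
pose q : balance n.+4 := ([set ord0; i], [set k; k'])%SET.
have q1 : tilt R i q = 1 /\ tilt R ord0 q = 1.
  have i0' : ord0 != i by rewrite eq_sym.
  rewrite /q !tilt_quad // !(eq_sym _ k) !(eq_sym _ k') !eqxx.
  rewrite (negPf ki) (negPf ki') (negPf k0) (negPf k0') (negPf i0) (negPf i0').
  by rewrite !addr0 !add0r !subr0.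
have [_ /negP[]] := diff_eq1 (etrans (AB q) q1.1).
by apply/gA/(gainP R); rewrite q1.2.
Qed.

Lemma tilt0_tiebreak (R : numDomainType) n (A B : {set balance n.+4}) :
  diff R A B =1 tilt R ord0 -> tiebreak A /\ tiebreak B = false.
Proof.
move=> AB; split; last first.
  apply/negP => /andP[/fintype.subsetP gB _].
  pose q : balance n.+4 := ([set ord0], [set ord_max])%SET.
  have q1 : tilt R ord0 q = 1 by rewrite tilt_pair subr0.
  have [_ /negP[]] := diff_eq1 (etrans (AB q) q1).
  exact/gB/(gainP R).
apply/andP; split.
  apply/fintype.subsetP => q /(gainP R) q1.
  by have [] := diff_eq1 (etrans (AB q) q1).
rewrite disjoint_sym disjoint_subset; apply/fintype.subsetP => q /(lossP R) q1.
have /diff_eq1[] // : diff R B A q = 1.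
by rewrite -[RHS]opprK -q1 -AB /diff opprB.
Qed.

(** The map [t] stands for the atoms of a subalgebra. By the pigeonhole
    principle, it identifies two loads of 0 against [j] and 0 against [k], and
    the set [loss j] separates them. *)
Lemma unresolved_tilt (C : finType) n (t : balance n.+4 -> C) :
  (#|C| < n.+3)%N ->
  exists2 j : 'I_n.+4, j != ord0 &
    exists q q', t q = t q' /\ (q \in loss j) != (q' \in loss j).
Proof.
move=> Cn.
pose r (j : 'I_n.+3) : balance n.+4 := ([set ord0], [set lift ord0 j])%SET.
have /injectivePn[j [k jk tE]] : ~~ injectiveb (t \o r).
  apply/injectiveP => /leq_card; rewrite card_ord leqNgt.
  by rewrite Cn.
exists (lift ord0 j); first by rewrite eq_sym neq_lift.
exists (r j), (r k); split=> //.
by rewrite !inE !cards1 !eqxx /= (inj_eq lift_inj) (negPf jk).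
Qed.

(** For the tilt [j] of [unresolved_tilt], a small mass at the load of 0 against
    [j] makes [gain ord0] heavier than [loss ord0]. The only other tie that it
    breaks is the one along the tilt of [j], which does not occur between sets
    measurable for [t]. *)
Lemma pref_representable (R : realFieldType) n (mu : balance n.+4 -> R)
    (C : finType) (t : balance n.+4 -> C) :
  (forall q, 0 < mu q) -> (forall A B, weight mu A = weight mu B ->
     A = B \/ exists i, diff R A B =1 tilt R i \/ diff R B A =1 tilt R i) ->
  (#|C| < n.+3)%N ->
  exists p : balance n.+4 -> R,
    [/\ forall q, 0 <= p q, \sum_q p q = 1 &
     forall A B : {set balance n.+4},
       (forall q q', t q = t q' -> (q \in A) = (q' \in A)) ->
       (forall q q', t q = t q' -> (q \in B) = (q' \in B)) ->
       pref mu A B = (weight p B <= weight p A)].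
Proof.
move=> mu0 tieP /(@unresolved_tilt _ _ t)[j j0 [q1 [q2 [tq loss_q]]]].
pose gaps := [seq (weight mu X.1 - weight mu X.2, 1 : R) |
  X <- enum [set: {set balance n.+4} * {set balance n.+4}]%SET].
have [e e0 eP] := small_step gaps.
pose r : balance n.+4 := ([set ord0], [set j])%SET.
pose nu q := mu q + e * (q == r)%:R.
have nu0 q : 0 < nu q by rewrite ltr_wpDr // mulr_ge0 // ltW.
have nuE A : weight nu A = weight mu A + e * (r \in A)%:R.
  rewrite /weight big_split /= -mulr_sumr; congr (_ + _ * _).
  rewrite big_mkcond (bigD1 r) //= eqxx big1 ?addr0; first by case: ifP.
  by move=> q /negPf->; case: ifP.
have S0 : 0 < \sum_q nu q.
  rewrite (bigD1 r) //= ltr_wpDr // sumr_ge0 // => q _; exact: ltW.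
exists (fun q => nu q / \sum_q nu q); split=> [q||A B tA tB].
- by rewrite divr_ge0 // ltW.
- by rewrite -mulr_suml divff // gt_eqF.
have normE X :
    weight (fun q => nu q / \sum_q nu q) X = weight nu X / \sum_q nu q.
  by rewrite /weight mulr_suml.
rewrite !normE ler_pM2r ?invr_gt0 // !nuE.
(* The added mass is smaller than every positive difference of weights. *)
have gap X Y : weight mu X < weight mu Y ->
    weight mu X + e * (r \in X)%:R < weight mu Y + e * (r \in Y)%:R.
  move=> XY; have /eP/= : (weight mu Y - weight mu X, 1) \in gaps.
    by apply/mapP; exists (Y, X) => //; rewrite mem_enum finset.in_setT.
  rewrite subr_gt0 normr1 mulr1 => /(_ XY) eXY.
  apply: (@lt_le_trans _ _ (weight mu Y)).
    rewrite addrC -ltrBrDr; apply: le_lt_trans eXY.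
    by rewrite ler_piMr ?(ltW e0) //; case: (_ \in _).
  by rewrite lerDl mulr_ge0 // ltW.
rewrite /pref; have [AB|BA|E] := ltgtP (weight mu A) (weight mu B).
- by rewrite /= leNgt gap.
- by rewrite /= ltW // gap.
rewrite /= E lerD2l ler_pM2l // ler_nat.
(* Between measurable sets of equal weight, [pref] and the added mass agree. *)
have tie X Y i : diff R X Y =1 tilt R i -> 
    (forall q q', t q = t q' -> (q \in X) = (q' \in X)) ->
    (forall q q', t q = t q' -> (q \in Y) = (q' \in Y)) ->
    if i == ord0 then [/\ tiebreak X, tiebreak Y = false, r \in X & r \notin Y]
    else [/\ tiebreak X = false, tiebreak Y = false & (r \in X) = (r \in Y)].
  move=> XY tX tY.
  have ij : i != j.
    apply: contraNneq loss_q => <-; apply/eqP.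
    suff lossE q : (q \in loss i) = (q \in Y) && (q \notin X).
      by rewrite !lossE (tX _ _ tq) (tY _ _ tq).
    apply/idP/andP => [/(lossP R)|[qY /negPf qX]]; rewrite -?XY.
      by move=> E'; apply: (@diff_eq1 R); rewrite -[RHS]opprK -E' /diff opprB.
    by apply/(lossP R); rewrite -XY /diff qY qX sub0r.
  case: eqP => [i0|/eqP i0].
    rewrite {}i0 in XY ij.
    have [bX bY] := tilt0_tiebreak XY.
    have [|rX rY] // := @diff_eq1 R _ X Y r.
    by rewrite XY tilt_pair eqxx (negPf ij) subr0.
  have [bX bY] := tilt_no_tiebreak i0 XY; split=> //.
  have := XY r; rewrite tilt_pair (negPf i0) (negPf ij) subrr => /eqP.
  by rewrite /diff subr_eq0 eqr_nat; do 2!case: (_ \in _).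
have [<-|[i [/tie|/tie]]] := tieP _ _ E; first by rewrite implybb leqnn.
  move=> /(_ tA tB); case: ifP => _ [-> -> rA]; first by rewrite rA => /negPf->.
  by rewrite rA leqnn.
move=> /(_ tB tA); case: ifP => _ [-> -> rB]; first by rewrite rB => /negPf->.
by rewrite rB leqnn.
Qed.

Lemma pref_total (R : realFieldType) n (mu : balance n.+4 -> R) A B :
  pref mu A B || pref mu B A.
Proof.
by rewrite /pref; case: ltgtP => //= _; case: (tiebreak A); case: (tiebreak B).
Qed.

Lemma pref_trans (R : realFieldType) n (mu : balance n.+4 -> R) A B C :
  pref mu A B -> pref mu B C -> pref mu A C.
Proof.
rewrite /pref => /orP[BA|/andP[/eqP-> bBA]].
  by case/orP => [CB|/andP[/eqP<- _]]; rewrite ?(lt_trans CB BA) ?BA.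
case/orP => [->//|/andP[-> bCB]]; rewrite /=.
by apply/orP; right; apply/implyP => bC; rewrite (implyP bBA) ?(implyP bCB).
Qed.

Lemma pref_subset (R : realFieldType) n (mu : balance n.+4 -> R)
    (A B : {set balance n.+4}) :
  (forall q, 0 < mu q) -> B \subset A -> pref mu A B.
Proof.
move=> mu0 BA; have [<-|neq] := eqVneq B A.
  by rewrite /pref eqxx implybb orbT.
have /properP[_ [q qA qB]] : B \proper A by rewrite finset.properEneq neq.
apply/orP; left; rewrite /weight [X in _ < X](finset.big_setID B) /=.
rewrite (finset.setIidPr BA) ltrDl (bigD1 q) /=; last by rewrite inE qA qB.
by rewrite ltr_wpDr // sumr_ge0 // => ? _; exact: ltW.
Qed.

Lemma pref_nondeg (R : realFieldType) n (mu : balance n.+4 -> R) :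
  (forall q, 0 < mu q) -> ~~ pref mu finset.set0 [set: balance n.+4]%SET.
Proof.
move=> mu0; rewrite /pref negb_or.
suff H : weight mu finset.set0 < weight mu [set: balance n.+4]%SET.
  by rewrite (lt_eqF H) -leNgt ltW.
rewrite {1}/weight big_set0 /weight (bigD1 (finset.set0, finset.set0)) /=;
  last by rewrite finset.in_setT.
by rewrite ltr_wpDr // sumr_ge0 // => q _; exact: ltW.
Qed.

(** Both facts are instances of the behaviour of moves along a tilt, applied to
    the move from [loss i] to [gain i] itself. *)
Lemma tiebreak_gain0 n : @tiebreak n (gain ord0).
Proof. by have [] := tilt0_tiebreak (frefl (tilt int (@ord0 n.+3))). Qed.

Lemma tiebreak_loss n (i : 'I_n.+4) : @tiebreak n (loss i) = false.
Proof.
have [->|i0] := eqVneq i ord0.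
  by have [] := tilt0_tiebreak (frefl (tilt int (@ord0 n.+3))).
by have [] := tilt_no_tiebreak i0 (frefl (tilt int i)).
Qed.

Lemma pref_gain (R : realFieldType) n (mu : balance n.+4 -> R) i :
  weight mu (gain i) = weight mu (loss i) -> pref mu (gain i) (loss i).
Proof. by move=> E; rewrite /pref E eqxx tiebreak_loss orbT. Qed.

Lemma pref_loss0N (R : realFieldType) n (mu : balance n.+4 -> R) :
  weight mu (gain ord0) = weight mu (loss ord0) ->
  ~~ pref mu (loss ord0) (gain ord0).
Proof. by move=> E; rewrite /pref E eqxx ltxx tiebreak_gain0 tiebreak_loss. Qed.

(** * Formulas and derivations *)

(** A strict upper bound on the letters, so that 0 means that there are none. *)
Fixpoint bletters (a : bform) : nat :=
  match a with
  | BLetter n => n.+1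
  | BBot => 0
  | BNeg b => bletters b
  | BAnd b c => maxn (bletters b) (bletters c)
  end.

Fixpoint cletters (f : cform) : nat :=
  match f with
  | CGeq a b => maxn (bletters a) (bletters b)
  | CNeg g => cletters g
  | CAnd g h => maxn (cletters g) (cletters h)
  end.

Lemma beval_letters K v w a : (forall n, (n < K)%N -> v n = w n) ->
  (bletters a <= K)%N -> beval v a = beval w a.
Proof.
move=> vw; elim: a => /= [n /vw//|//|b IH /IH->//|b IHb c IHc].
by rewrite geq_max => /andP[/IHb-> /IHc->].
Qed.

Lemma beval_subst v s a :
  beval v (bsubst s a) = beval (fun n => beval v (s n)) a.
Proof. by elim: a => //= [b ->|b -> c ->]. Qed.

Lemma bsubst_id a : bsubst BLetter a = a.
Proof. by elim: a => //= [b ->|b -> c ->]. Qed.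

Lemma csubst_id f : csubst BLetter f = f.
Proof. by elim: f => /= [a b|g ->|g -> h ->] //; rewrite !bsubst_id. Qed.

Lemma ceval_subst ge s f : ceval ge (csubst s f) =
  ceval (fun a b => ge (bsubst s a) (bsubst s b)) f.
Proof. by elim: f => //= [g ->|g -> h ->]. Qed.

Lemma ceval_letters K (ge ge' : bform -> bform -> bool) f :
  (forall a b, (bletters a <= K)%N -> (bletters b <= K)%N ->
     ge a b = ge' a b) ->
  (cletters f <= K)%N -> ceval ge f = ceval ge' f.
Proof.
move=> gg'; elim: f => /= [a b|g IH /IH->//|g IHg h IHh].
  by rewrite geq_max => /andP[aK bK]; exact: gg'.
by rewrite geq_max => /andP[/IHg-> /IHh->].
Qed.

(** The propositional evaluation of formulas under a comparison of Boolean
    formulas serves as a common semantics for probability models and for the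
    comparison [pref]. *)
Lemma sat_ceval (R : realType) (M : model R) f : sat M f <->
  ceval (fun a b => (model_prob M (model_val M b) <=
                     model_prob M (model_val M a))%E) f.
Proof.
elim: f => //= [g IH|g IHg h IHh].
  by rewrite IH; split => /negP.
by rewrite IHg IHh; split => /andP.
Qed.

Lemma derivable_sound (S : set cform) (ge : bform -> bform -> bool) :
  (forall a b c, ge a b -> ge b c -> ge a c) ->
  (forall a b, ge a b || ge b a) ->
  (forall a b, btautology (BImp b a) -> ge a b) ->
  ~~ ge BBot BTop ->
  (forall f s, S f -> ceval ge (csubst s f)) ->
  forall f, derivable S f -> ceval ge f.
Proof.
move=> geT geC geD geN geS f; elim=> {f} //=.
- move=> a b c; rewrite negb_and negbK -implybE.
  by apply/implyP => /andP[]; exact: geT.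
- by move=> a b; rewrite negb_and !negbK.
- by move=> f g _ + _ fT; rewrite fT /= negbK.
Qed.

(** * Finite models *)

(** The points of [T] are numbered and become point masses on the natural
    numbers, where every set is measurable. *)
Lemma weighted_model (R : realType) (T : finType) (p : T -> R)
    (v : T -> nat -> bool) :
  (forall q, 0 <= p q) -> \sum_q p q = 1 ->
  exists M : model R, forall a,
    model_prob M (model_val M a) = (weight p [set q | beval (v q) a]%SET)%:E.
Proof.
move=> p0 p1.
have [q0 _] : exists q0 : T, true.
  case: (pickP (@predT T)) => [q _|T0]; first by exists q.
  by move/eqP: p1; rewrite big_pred0 // eq_sym oner_eq0.
pose pt k := nth q0 (enum T) k.
pose mu : {measure set nat -> \bar R} := msum (fun k : nat =>
  mscale (NngNum (p0 (pt k))) (dirac k : {measure set nat -> \bar R})) #|T|.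
have muE A : mu A = (\sum_(q | index q (enum T) \in A) p q)%:E.
  rewrite /mu /= /msum.
  rewrite (reindex (@enum_val T predT)) /=; last first.
    by exists enum_rank => k _; rewrite ?enum_valK ?enum_rankK.
  rewrite [in RHS]big_mkcond /= -sumEFin; apply: eq_bigr => k _.
  rewrite /mscale /= diracE.
  have -> : enum_val k = pt k by rewrite /pt (enum_val_nth q0).
  rewrite /pt index_uniq ?enum_uniq -?cardE //.
  by case: (_ \in A); rewrite ?mule1 ?mule0.
have mu1 : mu setT = 1%E.
  by rewrite muE -p1; congr (_%:E); apply: eq_bigl => q; rewrite in_setT.
pose P : probability nat R :=
  HB.pack (mu : set nat -> \bar R) (Measure.class mu)
    (Measure_isProbability.Build _ _ _ mu mu1).
pose val a : set nat := mkset (fun k => beval (v (pt k)) a).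
have val0 : val BBot = set0 by apply/seteqP; split.
have valN a : val (BNeg a) = (~` val a)%classic.
  by apply/seteqP; split => k /= /negP.
have valA a b : val (BAnd a b) = (val a `&` val b)%classic.
  by apply/seteqP; split => k /= /andP.
have valL n : measurable (val (BLetter n)) by [].
exists (Model P val0 valN valA valL) => a /=.
rewrite -/(mu _) muE; congr (_%:E); apply: eq_bigl => q.
rewrite inE; apply/idP/idP; rewrite in_setE /val /= /pt nth_index ?mem_enum //.
Qed.

(** * The cancellation formula *)

Definition disj_all (s : seq bform) : bform :=
  BNeg (foldr (fun a b => BAnd (BNeg a) b) BTop s).

Lemma beval_disj_all v s : beval v (disj_all s) = has (beval v) s.
Proof.
rewrite /=; elim: s => //= a s <-.
by rewrite negb_and negbK.
Qed.

(** The letters stand for the points of [T]. In an arbitrary model they need not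
    be disjoint, so each point is described by its letter together with the
    negations of all others; these descriptions are mutually exclusive. *)
Definition only_letter (T : finType) (q : T) : bform :=
  BAnd (BLetter (enum_rank q))
    (BNeg (disj_all [seq BLetter (enum_rank q') | q' <- enum (predC1 q)])).

Definition describe (T : finType) (A : {set T}) : bform :=
  disj_all [seq only_letter q | q <- enum A].

Lemma beval_only_letter (T : finType) v (q : T) : beval v (only_letter q) =
  v (enum_rank q) && [forall (q' | q' != q), ~~ v (enum_rank q')].
Proof.
rewrite /only_letter [LHS]/= negbK; congr (_ && _).
have := beval_disj_all v [seq BLetter (enum_rank q') | q' <- enum (predC1 q)].
move=> /= /(congr1 negb); rewrite negbK => ->.
rewrite has_map -all_predC; apply/allP/forall_inP => H q' q'q.
  by apply: H; rewrite mem_enum.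
by apply: H; rewrite mem_enum in q'q.
Qed.

Lemma only_letter_disjoint (T : finType) v (q q' : T) :
  q != q' -> ~~ (beval v (only_letter q) && beval v (only_letter q')).
Proof.
move=> qq'; rewrite !beval_only_letter.
apply/negP => /andP[/andP[_ /forall_inP]].
by move=> /(_ q'); rewrite eq_sym => /(_ qq')/negPf->.
Qed.

Lemma describe_self (T : finType) (A : {set T}) (q : T) :
  beval (fun n => n == enum_rank q :> nat) (describe A) = (q \in A).
Proof.
rewrite beval_disj_all has_map.
apply: etrans (eq_has (beval_only_letter _) _) _.
apply/hasP/idP => [[q']|qA].
  by rewrite mem_enum => q'A /andP[/eqP/val_inj/enum_rank_inj<- _].
exists q; first by rewrite mem_enum.
rewrite eqxx /=.
apply/forall_inP => q'; apply: contra => /eqP/val_inj/enum_rank_inj->.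
by [].
Qed.

Lemma model_valE (R : realType) (M : model R) a : model_val M a =
  mkset (fun w => beval (fun n => `[<model_val M (BLetter n) w>]) a).
Proof.
elim: a => [n||b IH|b IHb c IHc].
- by apply/seteqP; split => w /asboolP.
- by rewrite model_val_bot; apply/seteqP; split.
- by rewrite model_val_neg IH; apply/seteqP; split => w /negP.
- by rewrite model_val_and IHb IHc; apply/seteqP; split => w /andP.
Qed.

Lemma measurable_val (R : realType) (M : model R) a :
  measurable (model_val M a).
Proof.
elim: a => [n||b IH|b IHb c IHc].
- exact: model_val_letter.
- by rewrite model_val_bot.
- by rewrite model_val_neg; exact: measurableC.
- by rewrite model_val_and; exact: measurableI.
Qed.

(** Every model induces a weight on the points of [T], by additivity over the
    mutually exclusive descriptions. *)
Lemma prob_describe (R : realType) (M : model R) (T : finType) :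
  exists w : T -> R, forall A : {set T},
    model_prob M (model_val M (describe A)) = (weight w A)%:E.
Proof.
exists (fun q => fine (model_prob M (model_val M (only_letter q)))) => A.
rewrite /weight /describe -big_enum /=.
elim: (enum A) (enum_uniq (mem A)) => [_|q s IH /= /andP[qs us]].
  rewrite big_nil /= model_val_neg /BTop /= model_val_neg model_val_bot.
  by rewrite classical_sets.setC0 classical_sets.setCT measure0.
rewrite big_cons EFinD -IH // fineK; last first.
  by rewrite fin_num_measure //; exact: measurable_val.
rewrite -measureU; [|exact: measurable_val|exact: measurable_val|].
  congr (model_prob M _); rewrite !model_valE; apply/seteqP; split => w /=.
    by rewrite negb_and negbK => /orP.
  by move=> [->|/negPf->]; rewrite ?andbF.
rewrite !model_valE; apply/seteqP; split => w // [].
rewrite /mkset beval_disj_all has_map => qw /hasP[q' q's q'w].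
have qq' : q != q' by apply: contraNneq qs => ->.
have := only_letter_disjoint (fun n => `[<model_val M (BLetter n) w>]) qq'.
by rewrite qw [beval _ _]q'w.
Qed.

Definition conj_all (s : seq cform) : cform := foldr CAnd (CGeq BTop BTop) s.

Lemma ceval_conj_all (ge : bform -> bform -> bool) s :
  ge BTop BTop -> ceval ge (conj_all s) = all (ceval ge) s.
Proof. by move=> ge1; elim: s => //= f s ->. Qed.

(** If no [gain i] is less likely than [loss i], the comparison of [gain 0] with
    [loss 0] is not strict. *)
Definition cancellation n : cform :=
  CImp (conj_all [seq CGeq (describe (gain i)) (describe (loss i))
                    | i <- enum 'I_n.+4])
       (CGeq (describe (loss (@ord0 n.+3))) (describe (gain (@ord0 n.+3)))).

Lemma ceval_cancellation (ge : bform -> bform -> bool) n : ge BTop BTop ->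
  ceval ge (cancellation n) =
  [forall i : 'I_n.+4, ge (describe (gain i)) (describe (loss i))] ==>
    ge (describe (loss (@ord0 n.+3))) (describe (gain (@ord0 n.+3))).
Proof.
move=> ge1; rewrite /cancellation /= ceval_conj_all // negb_and negbK -implybE.
congr (_ ==> _); rewrite all_map.
apply/allP/forallP => H i; last by move=> _; exact: H.
by apply: (H i); rewrite mem_enum.
Qed.

(** For the weights of a model, the differences between [gain i] and [loss i]
    sum to zero because the tilts do. If all are nonnegative, all vanish. *)
Lemma valid_cancellation (R : realType) n : valid R (cancellation n).
Proof.
move=> M; apply/sat_ceval; rewrite ceval_cancellation ?lexx //.
have [w wE] := prob_describe M (balance n.+4).
apply/implyP => /forallP H.
have {}H i : weight w (loss i) <= weight w (gain i).
  by have := H i; rewrite !wE lee_fin.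
rewrite !wE lee_fin -subr_le0.
have : \sum_i (weight w (gain i) - weight w (loss i)) = 0.
  under eq_bigr do rewrite -sum_diff.
  rewrite exchange_big big1 //= => q _.
  by rewrite -mulr_sumr -[X in _ * X]/(\sum_i tilt R i q) sum_tilt mulr0.
rewrite (bigD1 ord0) //= => /eqP; rewrite addr_eq0 => /eqP ->.
by rewrite oppr_le0 sumr_ge0 // => i _; rewrite subr_ge0.
Qed.

Theorem theorem6 (R : realType) :
  ~ exists S : set cform,
      finite_set S /\ forall f : cform, derivable S f <-> valid R f.
Proof.
move=> [S [finS SP]].
have [K SK] : exists K, forall f, S f -> (cletters f <= K)%N.
  have /finite_seqP[s sE] := finite_image cletters finS.
  exists (\max_(k <- s) k) => f Sf.
  have : (cletters @` S)%classic (cletters f) by exists f.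
  by rewrite sE /= => /leq_bigmax_seq ->.
(* Instances of the schemes only see subalgebras with at most [2 ^ K] atoms. *)
pose n := (2 ^ K)%N.
have [mu [mu0 muz tieP]] := balance_weight R n.+4.
(* Each point is the valuation that makes exactly its own letter true. *)
pose lv (q : balance n.+4) (k : nat) := k == enum_rank q.
pose ext a : {set balance n.+4} := [set q | beval (lv q) a]%SET.
pose ge a b := pref mu (ext a) (ext b).
have extD A : ext (describe A) = A.
  by apply/setP => q; rewrite inE describe_self.
have : ceval ge (cancellation n).
  apply: (derivable_sound (S := S)); last by apply/SP/valid_cancellation.
  - by move=> a b c; exact: pref_trans.
  - by move=> a b; exact: pref_total.
  - move=> a b ab; apply: pref_subset => //.
    apply/fintype.subsetP => q; rewrite !inE => qb.
    by have := ab (lv q); rewrite /= qb negbK.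
  - have ext0 : ext BBot = finset.set0 by apply/setP => q; rewrite !inE.
    have extT : ext BTop = [set: balance n.+4]%SET.
      by apply/setP => q; rewrite !inE.
    rewrite /ge ext0 extT.
    exact: pref_nondeg.
  move=> f s Sf; rewrite ceval_subst.
  (* The atoms of the subalgebra generated by the substituted formulas. *)
  pose t q := [ffun k : 'I_K => beval (lv q) (s k)].
  have [|p [p0 p1 pP]] := pref_representable t mu0 tieP.
    by rewrite card_ffun card_bool card_ord; do 2!apply: leqW.
  have [M ME] := weighted_model (fun q k => beval (lv q) (s k)) p0 p1.
  have /SP/(_ M)/sat_ceval fM : derivable S f.
    by rewrite -(csubst_id f); exact: der_scheme.
  apply: etrans fM; apply: ceval_letters (SK f Sf) => a b aK bK.
  have extS c : ext (bsubst s c) =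
      [set q | beval (fun k => beval (lv q) (s k)) c]%SET.
    by apply/setP => q; rewrite !inE beval_subst.
  have ext_t c : (bletters c <= K)%N -> forall q q', t q = t q' ->
      (q \in ext (bsubst s c)) = (q' \in ext (bsubst s c)).
    move=> cK q q' /ffunP tq; rewrite extS !inE.
    apply: beval_letters cK => k kK.
    by have := tq (Ordinal kK); rewrite !ffunE.
  by rewrite !ME lee_fin -!extS /ge pP //; exact: ext_t.
rewrite ceval_cancellation; last first.
  by rewrite /ge /pref eqxx implybb orbT.
move=> /implyP H.
have /negP[] := pref_loss0N (muz ord0).
rewrite -(extD (loss _)) -(extD (gain _)); apply: H.
by apply/forallP => i; rewrite /ge !extD; exact: pref_gain.
Qed.
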